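(* Let $(X,d_X)$ and $(Y,d_Y)$ be complete, doubling, quasiconvex metric spaces. Let $\Omega\subsetneq X$ be a bounded domain satisfying the bounded turning condition and $\Omega'\subsetneq Y$ be a bounded domain finitely connected at the boundary. Then a homeomorphism $f\in\mathcal F(\Omega,\Omega')$ extends to a continuous mapping $F:\overline\Omega\to\Omega''$, where $$\Omega'':=\Omega'\cup\bigcup_{x\in\partial\Omega}C(f,x).$$ Furthermore, $\Omega''=\overline{\Omega'}$.
   Context: Conventions. A domain is a nonempty open connected set. A curve is a continuous map from a compact interval (or its image). A metric space is quasiconvex if there is $C\ge 1$ such that any two points $x,y$ are joined by a curve of length at most $C\,d(x,y)$. Inner diameter distance in a domain $\Omega$: $d_{\rm inn}(x,y)=\inf \operatorname{diam}\gamma$, the infimum over all locally rectifiable curves $\gamma\subset\Omega$ joining $x,y\in\Omega$; for $A,B\subset\Omega$, $\mathrm{dist}_{\rm inn}(A,B)=\inf_{a\in A,b\in B}d_{\rm inn}(a,b)$. Class $\mathcal F$. A homeomorphism $f$ from $\Omega$ onto $\Omega'$ belongs to $\mathcal F(\Omega,\Omega')$ if for any two connected sets $E,F\subsetneq\Omega$: $\mathrm{dist}_{\rm inn}(E,F)=0$ if and only if $\mathrm{dist}_{\rm inn}(f(E),f(F))=0$ (the latter distance taken in $\Omega'$). Bounded turning. $\Omega$ satisfies the bounded turning condition (is linearly connected) if there is $L\ge1$ such that all $x,y\in\Omega$ lie in a continuum $K\subset\Omega$ with $\operatorname{diam}K\le L\,d_X(x,y)$. Finite connectedness. $\Omega'\subset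 Y$ is finitely connected at the boundary if for every $y\in\partial\Omega'$ and $r>0$ there is a bounded open set $U$ with $y\in U\subset B(y,r)$ such that $U\cap\Omega'$ has only finitely many components. Cluster set. For $x\in\partial\Omega$, $C(f,x):=\bigcap_U\overline{f(U\cap\Omega)}$, the intersection over all neighborhoods $U$ of $x$ in $X$. *)

(* Defs.v *)
(* MathComp-Analysis. Metric spaces are [metricType R] with [R : realType] and
   distance [mdist]. A map defined on a subset of a space is represented by a
   total function whose values off that subset are never used. *)
From HB Require Import structures.
From mathcomp Require Import all_boot all_order all_algebra.
From mathcomp Require Import boolp classical_sets functions cardinality.
From mathcomp Require Import set_interval reals ereal topology normedtype.
From mathcomp Require Import numfun.

Set Implicit Arguments.
Unset Strict Implicit.
Unset Printing Implicit Defensive.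

Import Order.TTheory GRing.Theory Num.Theory.
Import numFieldNormedType.Exports.

Local Open Scope classical_set_scope.
Local Open Scope ring_scope.

Section MetricNotions.
Context {R : realType} {X : metricType R}.
Implicit Types (A B E K O U : set X) (x y : X) (g : R -> X).

(* [X] is complete in the sense of [cauchy_cvg]; the library has no structure
   joining [metricType] with [completeType]. *)
Definition complete_space (T : metricType R) : Prop :=
  forall F : set_system T, ProperFilter F -> cauchy F -> exists l : T, F --> l.

Definition doubling_space (T : metricType R) : Prop :=
  exists N : nat, forall (x : T) (r : R), 0 < r ->
    exists s : seq T, (size s <= N)%N /\
      ball x r `<=` \bigcup_(c in [set` s]) ball c (r / 2).

(* Only meaningful for nonempty [A]: the supremum of the empty set is [-oo]. *)
Definition diam A : \bar R :=
  ereal_sup [set (mdist x y)%:E | x in A & y in A].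

Definition bounded_subset A : Prop :=
  exists M : R, forall x y, A x -> A y -> mdist x y <= M.

Definition domain O : Prop := [/\ O !=set0, open O & connected O].

Definition boundary A : set X := closure A `\` A°.

(* [itv_partition a b s] says that [a :: s] is a subdivision of [[a, b]]. *)
Definition curve_length (a b : R) g : \bar R :=
  ereal_sup [set (\sum_(0 <= i < size s)
                    mdist (g (nth b (a :: s) i)) (g (nth b (a :: s) i.+1)))%:E
            | s in [set s | itv_partition a b s]].

Definition joins_in A x y (a b : R) g : Prop :=
  [/\ a <= b, {within `[a, b], continuous g},
      g a = x, g b = y & g @` `[a, b] `<=` A].

Definition locally_rectifiable (a b : R) g : Prop :=
  forall c d : R, a <= c -> c <= d -> d <= b -> (curve_length c d g < +oo)%E.

Definition inner_dist O x y : \bar R :=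
  ereal_inf [set D | exists (a b : R) (g : R -> X),
    [/\ joins_in O x y a b g, locally_rectifiable a b g
      & D = diam (g @` `[a, b])]].

Definition inner_dist_sets O A B : \bar R :=
  ereal_inf [set inner_dist O x y | x in A & y in B].

Definition bounded_turning O : Prop :=
  exists2 L : R, 1 <= L & forall x y, O x -> O y ->
    exists K : set X, [/\ compact K, connected K, K `<=` O, K x /\ K y
      & (diam K <= (L * mdist x y)%:E)%E].

Definition finitely_connected_at_boundary O : Prop :=
  forall x (r : R), boundary O x -> 0 < r ->
    exists U : set X, [/\ open U, bounded_subset U, U x, U `<=` ball x r
      & finite_set (connected_component (U `&` O) @` (U `&` O))].

End MetricNotions.

Definition quasiconvex_space (R : realType) (X : metricType R) : Prop :=
  exists2 C : R, 1 <= C & forall x y : X, exists (a b : R) (g : R -> X),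
    joins_in setT x y a b g /\
    (curve_length a b g <= (C * mdist x y)%:E)%E.

Section Maps.
Context {R : realType} {X Y : metricType R}.
Implicit Types (O : set X) (V : set Y) (f : X -> Y).

Definition homeomorphism_on O V f : Prop :=
  [/\ set_bij O V f, {within O, continuous f}
    & exists2 g : Y -> X, {in O, cancel f g} & {within V, continuous g}].

Definition class_F O V f : Prop :=
  homeomorphism_on O V f /\
  forall E F : set X, connected E -> connected F -> E `<` O -> F `<` O ->
    (inner_dist_sets O E F = 0%E <-> inner_dist_sets V (f @` E) (f @` F) = 0%E).

Definition cluster_set O f (x : X) : set Y :=
  \bigcap_(U in nbhs x) closure (f @` (U `&` O)).

End Maps.

(* Main.v *)
(* Suppose the cluster set of [f] at a boundary point [x] contains [y1 <> y2].
   Both lie on the boundary of [Omega'], so finite connectedness there yields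
   connected sets [E] near [y1] and [F] near [y2] in [Omega'] whose preimages
   both accumulate at [x]. By bounded turning, points of the two preimages close
   to [x] lie in a small continuum of [Omega], and quasiconvexity replaces it by
   a rectifiable curve of nearly the same diameter; so the preimages are at
   inner distance 0, while [E] and [F] are at positive distance, which
   contradicts the class F condition. Closed bounded sets being compact, [f]
   then has a limit at every boundary point. *)
Require Import Defs.
From HB Require Import structures.
From mathcomp Require Import all_boot all_order all_algebra.
From mathcomp Require Import boolp classical_sets functions cardinality.
From mathcomp Require Import set_interval reals ereal topology normedtype.
From mathcomp Require Import numfun.
From mathcomp Require Import lra.

Import Order.TTheory GRing.Theory Num.Theory.
Import numFieldNormedType.Exports.

Local Open Scope classical_set_scope.
Local Open Scope ring_scope.

(** * Compactness of closed bounded sets and convergence of filters *)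

Lemma ultra_seq_cover (T : Type) (I : eqType) (F : set_system T) (s : seq I)
    (B : I -> set T) : UltraFilter F ->
  F (\bigcup_(i in [set` s]) B i) -> exists i, F (B i).
Proof.
move=> UF; elim: s => [|i s IHs] FB.
  have [x [j]] := filter_ex FB; by rewrite /= in_nil.
have [FBi|FnBi] := in_ultra_setVsetC (B i) UF; first by exists i.
apply: IHs; apply: filterS (filterI FB FnBi) => x [[j /= js Bjx] nBix].
exists j => //=; move: js; rewrite in_cons => /orP[/eqP ji|//].
by move: Bjx; rewrite ji.
Qed.

(** An ultrafilter containing a finite union contains one of its members. Repeated doubling
    therefore puts balls of radius [r / 2 ^+ n] into [F], which is then Cauchy; its limit lies in
    [A] because [A] is closed. *)
Lemma doubling_bounded_closed_compact (R : realType) (X : metricType R)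
    (A : set X) :
  complete_space X -> doubling_space X -> bounded_subset A -> closed A ->
  compact A.
Proof.
move=> cX [N dX] [M bA] clA; rewrite compact_ultra => F UF FA.
have [x0 Ax0] := filter_ex FA.
(* Balls are open and [M] may be 0; adding 1 makes the radius positive and the bound strict. *)
pose r := `|M| + 1.
have r0 : 0 < r by rewrite ltr_wpDl.
have small n : exists c, F (ball c (r / 2 ^+ n)).
  elim: n => [|n [c Fc]].
    exists x0; rewrite expr0 divr1; apply: filterS FA => x Ax.
    rewrite ballEmdist /=; apply: le_lt_trans (bA _ _ Ax0 Ax) _.
    by rewrite (le_lt_trans (ler_norm M))// ltrDl.
  have [|s [_ sc]] := dX c (r / 2 ^+ n); first by rewrite divr_gt0 ?exprn_gt0.
  have [c' Fc'] := ultra_seq_cover _ _ _ _ _ UF (filterS sc Fc).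
  by exists c'; rewrite exprSr invfM mulrA.
have [|l Fl] := cX F _.
  apply/cauchy_exP => e e0.
  have [n rn] : exists n, r / 2 ^+ n < e.
    have [n _ Hn] := near_infty_natSinv_expn_lt (PosNum (divr_gt0 e0 r0)).
    exists n; have := Hn n (leqnn n).
    by rewrite /= ltr_pdivlMr// mulrC mul1r.
  have [c Fc] := small n; exists c; apply: filterS Fc.
  exact: le_ball (ltW rn).
exists l; split => //; apply: clA => B /Fl FB.
by have [z] := filter_ex (filterI FA FB); exists z.
Qed.

(** If a neighbourhood [N] of [y] were not in [F], the trace of [F] on the complement of [N] would
    be proper and cluster in [V]. Its cluster point also belongs to [F], so it is [y], which [N]
    separates from the trace. *)
Lemma compact_cluster_subset1_cvg (T : topologicalType) (F : set_system T)
    (V : set T) (y : T) :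
  ProperFilter F -> compact V -> F V -> V `&` cluster F `<=` [set y] ->
  F --> y.
Proof.
move=> PF cV FV Fy N Ny; apply: contrapT => nFN.
have PG : ProperFilter (within (~` N) F).
  apply: Build_ProperFilter => F0; apply: nFN.
  by apply: (@filterS _ F _ _ _ _ F0) => x /= nNx; apply: contrapT => /nNx.
have [|p [Vp Gp]] := cV (within (~` N) F) PG.
  exact: (@filterS _ F _ _ _ _ FV).
have yp : p = y.
  apply: Fy; split => // B C FB; apply: Gp.
  exact: (@filterS _ F _ _ _ _ FB).
rewrite {}yp in Gp.
by have [x []] := Gp (~` N) N (withinT _ _) Ny.
Qed.

(** * Lengths of curves *)

Section Curves.
Context {R : realType} {X : metricType R}.
Implicit Types (A K O V : set X) (x y z : X) (g k : R -> X) (a b c d s t : R).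

Lemma le_mdist_diam A x y : A x -> A y -> ((mdist x y)%:E <= diam A)%E.
Proof. by move=> Ax Ay; apply: ereal_sup_ubound; exists x => //; exists y. Qed.

Lemma diam_le A (M : R) :
  (forall x y, A x -> A y -> mdist x y <= M) -> (diam A <= M%:E)%E.
Proof.
by move=> AM; apply: ge_ereal_sup => _ [x Ax [y Ay <-]]; rewrite lee_fin AM.
Qed.

Lemma mdist_le_inner_dist O x y : ((mdist x y)%:E <= inner_dist O x y)%E.
Proof.
apply: le_ereal_inf_tmp => _ [a [b [g [[ab _ gax gby _] _ ->]]]].
by rewrite -gax -gby; apply: le_mdist_diam; [exists a|exists b];
  rewrite //= in_itv /= lexx ab.
Qed.

Lemma inner_dist_sets_ge O A B (M : R) :
  (forall x y, A x -> B y -> M <= mdist x y) ->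
  (M%:E <= inner_dist_sets O A B)%E.
Proof.
move=> AB; apply: le_ereal_inf_tmp => _ [x Ax [y By <-]].
by rewrite (le_trans _ (mdist_le_inner_dist _ _ _))// lee_fin AB.
Qed.

(* Unlike [curve_length], a length function survives concatenation without
   splitting subdivisions. *)
Definition length_function a b g (l : R -> R) : Prop :=
  forall s t, a <= s -> s <= t -> t <= b -> mdist (g s) (g t) <= l t - l s.

Lemma sum_partition_rcons a b c g (p : seq R) :
  itv_partition a b p ->
  \sum_(0 <= i < size (rcons p c))
     mdist (g (nth c (a :: rcons p c) i)) (g (nth c (a :: rcons p c) i.+1)) =
  \sum_(0 <= i < size p) mdist (g (nth b (a :: p) i)) (g (nth b (a :: p) i.+1))
  + mdist (g b) (g c).
Proof.
move=> abp; rewrite size_rcons big_nat_recr//=; congr (_ + _); last first.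
  rewrite nth_rcons ltnn eqxx -rcons_cons nth_rcons /= ltnSn.
  by rewrite (set_nth_default b)//= (itv_partition_nth_size _ abp).
(* The default of [nth] is [c] on one side and [b] on the other; every index is in range, so the two
   may be exchanged. *)
rewrite !big_nat; apply: eq_bigr => i /andP[_ ip].
have ip' : (i < size (a :: p))%N by exact: ltnW.
rewrite -rcons_cons 2!nth_rcons ip' ip.
by rewrite (set_nth_default b)//= (set_nth_default b (s:=p)).
Qed.

Lemma sum_partition_le_length_function a b g l (p : seq R) :
  length_function a b g l -> itv_partition a b p ->
  \sum_(0 <= i < size p) mdist (g (nth b (a :: p) i)) (g (nth b (a :: p) i.+1))
    <= l b - l a.
Proof.
move=> gl abp; rewrite (le_trans (y := \sum_(0 <= i < size p)
   (l (nth b (a :: p) i.+1) - l (nth b (a :: p) i))))//; last first.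
  rewrite (telescope_sumr (fun i => l (nth b (a :: p) i)))//.
  by rewrite (itv_partition_nth_size _ abp).
rewrite !big_nat; apply: ler_sum => i /andP[_ ip]; apply: gl.
- by apply: itv_partition_nth_ge abp; rewrite ltnS ltnW.
- by case: abp => pp _; apply: ltW; move/pathP : pp => /(_ b); exact.
- by apply: itv_partition_nth_le abp; rewrite ltnS.
Qed.

Lemma length_function_locally_rectifiable a b g l :
  length_function a b g l -> locally_rectifiable a b g.
Proof.
move=> gl c d ac cd db; apply: (@le_lt_trans _ _ (l d - l c)%:E); last exact: ltry.
apply: ge_ereal_sup => _ [p pcd <-]; rewrite lee_fin.
apply: sum_partition_le_length_function pcd => s t cs st td.
by apply: gl => //; [exact: le_trans cs|exact: le_trans db].
Qed.

Lemma curve_length_ge0 a b g : a <= b -> (0 <= curve_length a b g)%E.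
Proof.
(* Some subdivision must be exhibited, the empty supremum being [-oo]: it is [[::]] for a degenerate
   interval and [[:: b]] otherwise. *)
rewrite le_eqVlt => /orP[/eqP<-|ab].
  apply: ereal_sup_ubound; exists [::]; first by split.
  by rewrite big_nil.
apply: ereal_sup_ge; eexists.
  by exists [:: b] => //; exact: itv_partition1.
by rewrite lee_fin sumr_ge0// => i _; exact: mdist_ge0.
Qed.

Lemma curve_length_addr a b c g : b <= c ->
  (curve_length a b g + (mdist (g b) (g c))%:E <= curve_length a c g)%E.
Proof.
rewrite le_eqVlt => /orP[/eqP<-|bc]; first by rewrite mdistxx adde0.
rewrite -leeBrDr//; apply: ge_ereal_sup => _ [p abp <-]; rewrite leeBrDr//.
rewrite -EFinD -(sum_partition_rcons _ _ _ _ _ abp).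
apply: ereal_sup_ubound; exists (rcons p c) => //.
by rewrite -cats1; apply: itv_partition_cat abp _; exact: itv_partition1.
Qed.

(** Arc length from [a] turns a curve of finite length into one with a length function. Taking
    [fine] loses nothing, since an initial arc is no longer than the whole curve. *)
Lemma curve_length_function a b g : (curve_length a b g < +oo)%E ->
  length_function a b g (fun t => fine (curve_length a t g)).
Proof.
move=> gab s t sa st tb.
have fin u : a <= u -> u <= b -> curve_length a u g \is a fin_num.
  move=> au ub; rewrite ge0_fin_numE; last exact: curve_length_ge0.
  apply: le_lt_trans gab; apply: le_trans (curve_length_addr a _ _ g ub).
  by rewrite leeDl// lee_fin mdist_ge0.
have at' := le_trans sa st; have sb := le_trans st tb.
by rewrite lerBrDl -lee_fin EFinD !fineK ?fin ?curve_length_addr.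
Qed.

Lemma mdist_le_curve_length a b g s t : a <= s -> s <= t -> t <= b ->
  ((mdist (g s) (g t))%:E <= curve_length a b g)%E.
Proof.
move=> sa st tb; apply: le_trans (curve_length_addr a _ _ g tb).
rewrite (le_trans _ (leeDl _ _)) ?lee_fin ?mdist_ge0//.
apply: le_trans (curve_length_addr a _ _ g st).
by rewrite leeDr// curve_length_ge0.
Qed.

End Curves.

(** * Rectifiable curves inside open sets *)

Section RectifiableJoining.
Context {R : realType} {X : metricType R}.
Implicit Types (A K O V : set X) (x y z : X).

Definition rectifiably_joined V x y : Prop :=
  exists (a b : R) (g : R -> X) (l : R -> R),
    joins_in V x y a b g /\ length_function a b g l.

(** Concatenation needs adjacent parameter intervals, so the second curve is translated to start
    where the first one ends. *)
Lemma joins_in_shift V x y (a b c : R) (g : R -> X) :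
  joins_in V x y a b g ->
  joins_in V x y c (c + (b - a)) (fun t => g (t - c + a)).
Proof.
have shift_itv t : `[c, c + (b - a)]%classic t -> `[a, b]%classic (t - c + a).
  by rewrite /= !in_itv /= => /andP[? ?]; apply/andP; split; lra.
move=> [ab /subspace_continuousP cg gax gby gV]; split.
- by rewrite lerDl subr_ge0.
- apply/subspace_continuousP => t ct.
  have shift_continuous : continuous (fun s : R => s - c + a).
    by move=> s; do 2![apply: (@cvgD _ R^o); last exact: cvg_cst]; exact: cvg_id.
  have := cg _ (shift_itv t ct); apply: cvg_trans => W /(shift_continuous t) tW.
  by apply: (@filterS _ (nbhs t) _ _ _ _ tW) => s Ws /shift_itv /Ws.
- by rewrite -gax; congr g; lra.
- by rewrite -gby; congr g; lra.
- by move=> _ [t ct <-]; apply: gV; exists (t - c + a) => //; exact: shift_itv.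
Qed.

Lemma length_function_shift (a b c : R) (g : R -> X) (l : R -> R) :
  length_function a b g l ->
  length_function c (c + (b - a)) (fun t => g (t - c + a))
    (fun t => l (t - c + a)).
Proof.
by move=> gl s t cs st tb; apply: gl; lra.
Qed.

Lemma joins_in_cat V x y z (a b c : R) (g k : R -> X) :
  joins_in V x y a b g -> joins_in V y z b c k ->
  joins_in V x z a c (fun t => if t <= b then g t else k t).
Proof.
move=> [ab cg gax gby gV] [bc ck kby kcz kV].
have abc : `[a, c]%classic = `[a, b]%classic `|` `[b, c]%classic.
  apply/seteqP; split => t /=; rewrite !in_itv /=.
    by move=> /andP[at' tc]; have [tb|/ltW bt] := leP t b; [left|right]; apply/andP.
  move=> [/andP[at' tb]|/andP[bt tc]]; apply/andP; split => //.
    exact: le_trans tb bc.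
  exact: le_trans ab bt.
have hk t : b <= t -> (if t <= b then g t else k t) = k t.
  by rewrite le_eqVlt => /orP[/eqP <-|bt]; [rewrite lexx gby kby|rewrite leNgt bt].
split.
- exact: le_trans ab bc.
- rewrite abc; apply: withinU_continuous.
  + exact: itv_closed.
  + exact: itv_closed.
  + apply: subspace_eq_continuous cg => t.
    by rewrite inE /= in_itv /= /from_subspace => /andP[_ ->].
  + apply: subspace_eq_continuous ck => t.
    by rewrite inE /= in_itv /= => /andP[bt _]; rewrite /from_subspace hk.
- by rewrite ab.
- by rewrite hk.
- move=> _ [t act <-]; move: act; rewrite abc => -[abt|bct].
    apply: gV; exists t => //; move: abt.
    by rewrite /= in_itv /= => /andP[_ ->].
  apply: kV; exists t => //; move: bct.
  by rewrite /= in_itv /= => /andP[bt _]; rewrite hk.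
Qed.

(** The constant [l b - m b] added to [m] makes the two length functions agree at [b]; across [b]
    the triangle inequality goes through [g b]. *)
Lemma length_function_cat (a b c : R) (g k : R -> X) (l m : R -> R) :
  g b = k b -> length_function a b g l -> length_function b c k m ->
  length_function a c (fun t => if t <= b then g t else k t)
    (fun t => if t <= b then l t else l b + (m t - m b)).
Proof.
move=> gk gl km s t as' st tc; have [tb|bt] := leP t b.
  by rewrite (le_trans st tb); exact: gl.
have [sb|bs] := leP s b; last first.
  by rewrite opprD addrACA subrr add0r opprB addrA subrK; apply: km => //; exact: ltW.
rewrite (le_trans (metric_triangle _ (g b) _))//.
rewrite addrAC lerD// ?gl// gk km//; exact: ltW.
Qed.

Lemma rectifiably_joined_trans V x y z :
  rectifiably_joined V x y -> rectifiably_joined V y z ->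
  rectifiably_joined V x z.
Proof.
move=> [a [b [g [l [gxy gl]]]]] [c [d [k [m [kyz km]]]]].
have kyz' := joins_in_shift _ _ _ _ _ b _ kyz.
do 4 eexists; split; first exact: joins_in_cat gxy kyz'.
apply: length_function_cat gl (length_function_shift _ _ b _ _ km).
by case: gxy => _ _ _ -> _; case: kyz' => _ _ -> _ _.
Qed.

(** A curve of length less than [e] with one end at [x] stays in the ball of radius [e] around [x].
    Quasiconvexity is applied to both orders of the endpoints, so no curve has to be reversed. *)
Lemma rectifiably_joined_near V x : quasiconvex_space X -> open V -> V x ->
  \forall y \near x,
    [/\ V y, rectifiably_joined V x y & rectifiably_joined V y x].
Proof.
move=> [C C1 qX] oV Vx.
have C0 : 0 < C by exact: lt_le_trans C1.
have [e /= e0 xeV] : nbhs_ball x V by rewrite nbhs_ballE; exact: open_nbhs_nbhs.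
apply/nbhs_ballP; exists (e / C) => /=; first exact: divr_gt0.
move=> y; rewrite ballEmdist /= ltr_pdivlMr// mulrC => xy.
have short u v : C * mdist u v < e -> 
  exists (a b : R) (g : R -> X) (l : R -> R), [/\ joins_in setT u v a b g,
    length_function a b g l & forall s t, a <= s -> s <= t -> t <= b ->
      mdist (g s) (g t) < e].
  move=> uv; have [a [b [g [guv gl]]]] := qX u v.
  exists a, b, g; eexists; split => //.
    by apply: curve_length_function; apply: le_lt_trans gl (ltry _).
  move=> s t sa st tb; rewrite (le_lt_trans _ uv)// -lee_fin.
  by apply: le_trans gl; exact: mdist_le_curve_length.
split.
- apply: xeV; rewrite ballEmdist /=; apply: le_lt_trans xy.
  by rewrite ler_peMl// mdist_ge0.
- have [a [b [g [l [[ab cg ga gb _] gl ge]]]]] := short _ _ xy.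
  exists a, b, g, l; split => //; split => // _ [t /= + <-].
  rewrite in_itv /= => /andP[at' tb]; apply: xeV; rewrite ballEmdist /= -ga.
  exact: ge.
- rewrite metric_sym in xy.
  have [a [b [g [l [[ab cg ga gb _] gl ge]]]]] := short _ _ xy.
  exists a, b, g, l; split => //; split => // _ [t /= + <-].
  rewrite in_itv /= => /andP[at' tb]; apply: xeV; rewrite ballEmdist /= -gb.
  by rewrite metric_sym; exact: ge.
Qed.

(** The points of [K] that can be reached from [x] form a relatively open and closed subset of [K]:
    by the previous lemma, nearby points are joined in both directions. *)
Lemma connected_rectifiably_joined V K x y :
  quasiconvex_space X -> open V -> connected K -> K `<=` V -> K x -> K y ->
  rectifiably_joined V x y.
Proof.
move=> qX oV cK KV Kx Ky.
pose B := K `&` [set z | rectifiably_joined V x z].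
suff : B = K by move=> BK; move: Ky; rewrite -BK => -[].
apply: cK.
- exists x; split => //.
  by have /nbhs_singleton[] := rectifiably_joined_near _ _ qX oV (KV _ Kx).
- exists (V `&` [set z | rectifiably_joined V x z]).
    rewrite openE => z [Vz xz].
    apply: filterS (rectifiably_joined_near _ _ qX oV Vz) => w [Vw zw _].
    by split => //; exact: rectifiably_joined_trans zw.
  by rewrite /B setIA (setIidl KV).
- exists (~` (V `&` [set z | ~ rectifiably_joined V x z])).
    apply: open_closedC; rewrite openE => z [Vz xz].
    apply: filterS (rectifiably_joined_near _ _ qX oV Vz) => w [Vw _ wz].
    by split => // xw; apply: xz; exact: rectifiably_joined_trans wz.
  apply/seteqP; split => z [Kz xz]; split => //.
    by move=> [_].
  by apply: contrapT => nxz; apply: xz; split => //; exact: KV.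
Qed.

Lemma inner_dist_sets_turning_eq0 O A B x :
  quasiconvex_space X -> open O -> bounded_turning O ->
  A `<=` O -> B `<=` O -> closure A x -> closure B x ->
  inner_dist_sets O A B = 0%E.
Proof.
move=> qX oO [L L1 tO] AO BO Ax Bx; apply/eqP; rewrite eq_le; apply/andP; split.
  apply/lee_addgt0Pr => e e0; rewrite add0e.
  have L0 : 0 < L by exact: lt_le_trans L1.
  (* Points within [d] of [x] are less than [2 * d] apart, so [K] has diameter at most [e / 2]. Its
     [e / 4]-neighbourhood then has diameter at most [e]. *)
  pose d := e / 4 / L.
  have d0 : 0 < d by rewrite !divr_gt0.
  have [a [Aa]] := Ax _ (nbhsx_ballx x d d0).
  have [b [Bb]] := Bx _ (nbhsx_ballx x d d0).
  rewrite !ballEmdist /= => xb xa.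
  have [K [_ cK KO [Ka Kb] dK]] := tO a b (AO _ Aa) (BO _ Bb).
  (* The continuum [K] itself may contain no rectifiable curve; this open neighbourhood of it
     does. *)
  pose V := O `&` \bigcup_(k in K) (ball k (e / 4))°.
  have e4 : 0 < e / 4 by exact: divr_gt0.
  have [||s [t [g [l [[st cg gs gt gV] gl]]]]] :=
    connected_rectifiably_joined V K a b qX _ cK _ Ka Kb.
  - by apply: openI => //; apply: bigcup_open => k _; exact: open_interior.
  - by move=> k Kk; split; [exact: KO|exists k => //; exact: nbhsx_ballx].
  apply: (@le_trans _ _ (inner_dist O a b)).
    by apply: ereal_inf_lbound; exists a => //; exists b.
  apply: (@le_trans _ _ (diam (g @` `[s, t]))).
    apply: ereal_inf_lbound; exists s, t, g; split => //.
      by split => // ? /gV[].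
    exact: length_function_locally_rectifiable gl.
  apply: diam_le => u v /gV[_ [k Kk]] + /gV[_ [k' Kk']].
  rewrite !ballEmdist => /interior_subset/= ku /interior_subset/= k'v.
  have kk' : mdist k k' <= e / 2.
    rewrite -lee_fin (le_trans (le_mdist_diam _ _ _ Kk Kk'))// (le_trans dK)//.
    rewrite lee_fin -ler_pdivlMl//.
    rewrite (le_trans (metric_triangle _ x _))// metric_sym.
    apply: le_trans (lerD (ltW xa) (ltW xb)) _.
    rewrite /d -mulrDl mulrC.
    by have -> : e / 4 + e / 4 = e / 2 by lra.
  have := metric_triangle u k v; have := metric_triangle k k' v.
  rewrite (metric_sym u k).
  by move=> ? ?; lra.
apply: inner_dist_sets_ge => u v _ _; exact: mdist_ge0.
Qed.

End RectifiableJoining.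

(** * Cluster sets and the extension to the closure *)

Lemma within_proper (T : topologicalType) (A : set T) (x : T) :
  closure A x -> ProperFilter (within A (nbhs x)).
Proof.
by move=> Ax; apply: Build_ProperFilter => /Ax[z [Az /(_ Az)]].
Qed.

Section Extension.
Context {R : realType} {X Y : metricType R}.
Implicit Types (O : set X) (V : set Y) (f : X -> Y) (g : Y -> X).

Lemma boundary_open (T : metricType R) (A : set T) (x : T) :
  open A -> boundary A x <-> closure A x /\ ~ A x.
Proof. by move=> /interior_id oA; rewrite /boundary oA. Qed.

Lemma cluster_setP (S T : metricType R) (O : set S) (f : S -> T) x y : cluster_set O f x y <->
  forall U N, nbhs x U -> nbhs y N -> exists z, [/\ U z, O z & N (f z)].
Proof.
split=> [xy U N xU yN|xy U xU N yN].
  by have [_ [[z [Uz Oz] <-] Nz]] := xy U xU N yN; exists z.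
by have [z [Uz Oz Nz]] := xy U N xU yN; exists (f z); split => //; exists z.
Qed.

Lemma cluster_set_closure O V f x :
  set_fun O V f -> cluster_set O f x `<=` closure V.
Proof.
move=> fV y /cluster_setP xy N yN.
by have [z [_ /fV Vz Nz]] := xy _ _ filterT yN; exists (f z).
Qed.

Lemma homeomorphism_inverse O V f : homeomorphism_on O V f ->
  exists g, [/\ forall y, V y -> O (g y) /\ f (g y) = y,
    {in O, cancel f g} & {within V, continuous g}].
Proof.
move=> [[_ _ fO] _ [g fK cg]]; exists g; split => // y /fO[x Ox <-].
by rewrite fK ?inE.
Qed.

Lemma cluster_set_in (S T : metricType R) (O : set S) (f : S -> T) x :
  {within O, continuous f} -> O x -> cluster_set O f x `<=` [set f x].
Proof.
move=> /subspace_continuousP cf Ox y /cluster_setP xy.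
apply: metric_hausdorff => A B yA /(cf _ Ox) xB.
by have [z [/= zB /zB Bz Az]] := xy _ _ xB yA; exists (f z).
Qed.

(** The cluster relation is symmetric: [x] is in the cluster set of the inverse [g] at [y]. Were [y]
    in [V], continuity of [g] there would force [x = g y], a point of [O]. *)
Lemma cluster_set_boundary O V f x : open O -> open V ->
  homeomorphism_on O V f -> boundary O x ->
  cluster_set O f x `<=` boundary V.
Proof.
move=> oO oV hf /(boundary_open _ _ _ oO)[_ nOx] y xy.
apply/(boundary_open _ _ _ oV); split.
  by apply: cluster_set_closure xy; case: hf => -[].
move=> Vy; have [g [gO fK cg]] := homeomorphism_inverse _ _ _ hf.
have /(cluster_set_in _ _ _ _ _ cg Vy) xgy : cluster_set V g y x.
  apply/cluster_setP => N U yN xU.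
  move/cluster_setP : xy => /(_ _ _ xU yN)[z [Uz Oz Nz]].
  exists (f z); rewrite fK ?inE//; split => //.
  by case: hf => -[fV _ _] _ _; exact: fV.
by apply: nOx; rewrite xgy; case: (gO _ Vy).
Qed.

(** The closures of the preimages of the finitely many components of [U] in [V] have a closed union.
    If [x] were outside it, some [z] near [x] would avoid it while [f z] lies in [U]; but [z] is in
    the preimage of the component of [f z]. *)
Lemma component_at_cluster_point O V f g x y (r : R) :
  set_fun O V f -> {in O, cancel f g} ->
  finitely_connected_at_boundary V -> boundary V y -> cluster_set O f x y ->
  0 < r ->
  exists E, [/\ connected E, E `<=` V, E `<=` ball y r & closure (g @` E) x].
Proof.
move=> fV fK fcV bVy /cluster_setP xy r0.
have [U [oU _ Uy Ur fin]] := fcV y r bVy r0.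
set D := connected_component (U `&` V) @` (U `&` V) in fin.
have clD : closed (\bigcup_(E in D) closure (g @` E)).
  by apply: closed_bigcup => // E _; exact: closed_closure.
have [[E DE xE]|nx] := pselect ((\bigcup_(E in D) closure (g @` E)) x).
  case: DE xE => v _ <- xE; eexists; split; last exact: xE.
  - exact: component_connected.
  - by move=> w /connected_component_sub[].
  - by move=> w /connected_component_sub[/Ur].
have [||z [nz Oz Uz]] := xy (~` \bigcup_(E in D) closure (g @` E)) U.
- by apply: open_nbhs_nbhs; split => //; exact: closed_openC.
- exact: open_nbhs_nbhs.
exfalso; apply: nz; have UVz : (U `&` V) (f z) by split => //; exact: fV.
exists (connected_component (U `&` V) (f z)); first by exists (f z).
apply: subset_closure; exists (f z); first exact: connected_component_refl.
by rewrite fK ?inE.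
Qed.

Lemma cluster_set_unique O V f x y1 y2 : quasiconvex_space X ->
  open O -> open V -> bounded_turning O -> finitely_connected_at_boundary V ->
  class_F O V f -> boundary O x ->
  cluster_set O f x y1 -> cluster_set O f x y2 -> y1 = y2.
Proof.
move=> qX oO oV tO fcV [hf fF] bx xy1 xy2; apply: mdist_positivity.
apply: contrapT => /eqP; rewrite neq_lt ltNge mdist_ge0 /= => y12.
have [g [gV fK cg]] := homeomorphism_inverse _ _ _ hf.
have fV : set_fun O V f by case: hf => -[].
(* Sets within [r] of [y1] and of [y2] remain at least [2 * r] apart. *)
pose r := mdist y1 y2 / 4; have r0 : 0 < r by exact: divr_gt0.
have piece y : cluster_set O f x y -> exists E, [/\ connected E, E `<=` V,
    E `<=` ball y r & closure (g @` E) x].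
  move=> xy; have bVy := cluster_set_boundary _ _ _ _ oO oV hf bx _ xy.
  exact: component_at_cluster_point fV fK fcV bVy xy r0.
have [E [cE EV Ey1 xE]] := piece _ xy1.
have [F [cF FV Fy2 xF]] := piece _ xy2.
have far u v : E u -> F v -> r <= mdist u v.
  move=> /Ey1 + /Fy2; rewrite !ballEmdist /r /= => y1u y2v.
  have := metric_triangle y1 u y2; have := metric_triangle u v y2.
  by rewrite (metric_sym v y2) => ? ?; lra.
have pullback A : connected A -> A `<=` V ->
    [/\ connected (g @` A), g @` A `<=` O & f @` (g @` A) = A].
  move=> cA AV; split.
  - by apply: connected_continuous_connected => //; exact: continuous_subspaceW cg.
  - by move=> _ [y /AV/gV[Oy _] <-].
  - rewrite image_comp; apply/seteqP; split => [_ [y Ay <-]|y Ay] /=.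
      by have [_ ->] := gV _ (AV _ Ay).
    by exists y => //=; have [_ ->] := gV _ (AV _ Ay).
have [cgE gEO fgE] := pullback _ cE EV.
have [cgF gFO fgF] := pullback _ cF FV.
have [_ [[u Eu _] _]] := xE _ filterT.
have [_ [[v Fv _] _]] := xF _ filterT.
(* Disjointness makes each preimage a proper subset of [O], as [class_F] demands: it misses the
   other preimage, which is nonempty. *)
have disj w : E w -> ~ F w by move=> Ew /(far _ _ Ew); rewrite mdistxx leNgt r0.
have gEO' : g @` E `<` O.
  split => // OgE; apply: (disj v) => //; rewrite -fgE; exists (g v).
    by apply: OgE; apply: gFO; exists v.
  by have [] := gV _ (FV _ Fv).
have gFO' : g @` F `<` O.
  split => // OgF; apply: (disj u) => //; rewrite -fgF; exists (g u).
    by apply: OgF; apply: gEO; exists u.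
  by have [] := gV _ (EV _ Eu).
have [+ _] := fF _ _ cgE cgF gEO' gFO'; rewrite fgE fgF.
rewrite (inner_dist_sets_turning_eq0 _ _ _ x)// => /(_ erefl) EF0.
by have := inner_dist_sets_ge V _ _ _ far; rewrite EF0 lee_fin leNgt r0.
Qed.

(** Cluster points of [f] along the trace of the neighbourhoods of [x] lie in the cluster set.
    Compactness provides one, and uniqueness turns it into a limit. *)
Lemma cluster_set_cvg O V f x : compact (closure V) -> set_fun O V f ->
  closure O x ->
  (forall y1 y2, cluster_set O f x y1 -> cluster_set O f x y2 -> y1 = y2) ->
  exists2 y, cluster_set O f x y & f @ within O (nbhs x) --> y.
Proof.
move=> cV fV clx uniq; have PO := within_proper _ _ _ clx.
have VF : (f @ within O (nbhs x)) (closure V).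
  by apply: filterS (withinT _ _) => z /fV Vz; exact: subset_closure.
have clusterE : cluster (f @ within O (nbhs x)) `<=` cluster_set O f x.
  move=> y xy U xU N yN; apply: xy => //.
  by apply: filterS xU => z Uz Oz; exists z.
have [y [_ /clusterE xy]] := cV (f @ within O (nbhs x)) _ VF.
exists y => //; apply: compact_cluster_subset1_cvg cV VF _.
by move=> z [_ /clusterE xz]; exact: uniq.
Qed.

Lemma continuous_extension_closure O f (F : X -> Y) :
  (forall x, closure O x -> f @ within O (nbhs x) --> F x) ->
  {within closure O, continuous F}.
Proof.
move=> fF; apply/subspace_continuousP => x clx.
apply/cvg_ballP => e e0.
have e2 : 0 < e / 2 by exact: divr_gt0.
have /= xF := fF x clx _ (nbhsx_ballx _ _ e2).
(* A neighbourhood of [x] is one of every [w] near [x], so some [z] in [O] has [f z] within [e / 2]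
   of both [F x] and [F w]. *)
have /= := nbhs_interior xF; apply: filterS => w wF clw.
have PO := within_proper _ _ _ clw.
have wO : within O (nbhs w) (f @^-1` ball (F x) (e / 2)) by exact: wF.
have wFw := fF w clw _ (nbhsx_ballx _ _ e2).
have [z [zx zw]] := filter_ex (filterI wO wFw).
exact: ball_splitl zx zw.
Qed.

End Extension.

Lemma bounded_subset_closure (R : realType) (X : metricType R) (A : set X) :
  bounded_subset A -> bounded_subset (closure A).
Proof.
(* Each of the two points is within 1 of a point of [A]. *)
move=> [M bM]; exists (M + 2) => x y clx cly.
have [a [Aa]] := clx _ (nbhsx_ballx x _ ltr01).
have [b [Ab]] := cly _ (nbhsx_ballx y _ ltr01).
rewrite !ballEmdist /= metric_sym => yb xa.
have := bM _ _ Aa Ab; have := metric_triangle x a y.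
by have := metric_triangle a b y => ? ? ?; lra.
Qed.

(** Near [y] the inverse of [f] takes values in a compact set, so it accumulates at some [x] in the
    closure of [O], and [y] is in the cluster set at [x]. If [x] is in [O], then [y = f x];
    otherwise [x] is a boundary point. *)
Lemma closure_sub_cluster_sets (R : realType) (X Y : metricType R) (O : set X)
    (V : set Y) (f : X -> Y) :
  compact (closure O) -> open O -> homeomorphism_on O V f ->
  closure V `<=` V `|` \bigcup_(x in boundary O) cluster_set O f x.
Proof.
move=> cO oO hf y cly.
have [g [gV fK _]] := homeomorphism_inverse _ _ _ hf.
have [[fV _ _] cf _] := hf.
have PV := within_proper _ _ _ cly.
have OG : (g @ within V (nbhs y)) (closure O).
  apply: filterS (withinT _ _) => v /gV[Ogv _]; exact: subset_closure.
have [x [clx gx]] := cO (g @ within V (nbhs y)) _ OG.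
have xy : cluster_set O f x y.
  apply/cluster_setP => U N xU yN.
  have [|_ [[v [Vv Nv] <-] Ugv]] := gx (g @` (V `&` N)) U _ xU.
    by apply: filterS yN => v Nv Vv; exists v.
  by have [Ogv fgv] := gV _ Vv; exists (g v); rewrite fgv.
have [Ox|nOx] := pselect (O x).
  by left; rewrite (cluster_set_in _ _ _ _ _ cf Ox _ xy); exact: fV.
by right; exists x => //; exact/boundary_open.
Qed.

Theorem corollary2 (R : realType) (X Y : metricType R)
    (X_complete : complete_space X) (X_doubling : doubling_space X)
    (X_quasiconvex : quasiconvex_space X)
    (Y_complete : complete_space Y) (Y_doubling : doubling_space Y)
    (Y_quasiconvex : quasiconvex_space Y)
    (Omega : set X) (Omega_proper : Omega `<` setT)
    (Omega_domain : domain Omega) (Omega_bounded : bounded_subset Omega)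
    (Omega_turning : bounded_turning Omega)
    (Omega' : set Y) (Omega'_proper : Omega' `<` setT)
    (Omega'_domain : domain Omega') (Omega'_bounded : bounded_subset Omega')
    (Omega'_fin_conn : finitely_connected_at_boundary Omega')
    (f : X -> Y) (f_classF : class_F Omega Omega' f) :
  let Omega'' :=
    Omega' `|` \bigcup_(x in boundary Omega) cluster_set Omega f x in
  (exists F : X -> Y,
    [/\ {in Omega, F =1 f},
        {within closure Omega, continuous F}
      & set_fun (closure Omega) Omega'' F]) /\
  Omega'' = closure Omega'.
Proof.
move=> Omega''.
have [_ oO _] := Omega_domain; have [_ oO' _] := Omega'_domain.
have [hf _] := f_classF; have [[fO' _ _] cf _] := hf.
have cptO : compact (closure Omega).
  apply: doubling_bounded_closed_compact => //; last exact: closed_closure.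
  exact: bounded_subset_closure.
have cptO' : compact (closure Omega').
  apply: doubling_bounded_closed_compact => //; last exact: closed_closure.
  exact: bounded_subset_closure.
split; last first.
  apply/seteqP; split; last exact: closure_sub_cluster_sets.
  move=> y [/subset_closure//|[x _]]; exact: cluster_set_closure.
(* The choice ranges over all of [X]; off the closure of [Omega] the value [f x] is only a
   placeholder. *)
have /choice[F FP] : forall x, exists y, [/\ Omega x -> y = f x,
    closure Omega x -> f @ within Omega (nbhs x) --> y &
    boundary Omega x -> cluster_set Omega f x y].
  move=> x; have [Ox|nOx] := pselect (Omega x).
    exists (f x); split => //; last by move=> /(boundary_open _ _ _ oO)[].
    by move=> _; move/subspace_continuousP : cf; exact.
  have [clx|nclx] := pselect (closure Omega x); last first.
    by exists (f x); split => // /(boundary_open _ _ _ oO)[].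
  have bx : boundary Omega x by exact/boundary_open.
  have [y1 y2|y xy fy] := cluster_set_cvg _ _ _ _ cptO' fO' clx.
    exact: cluster_set_unique f_classF bx.
  by exists y.
exists F; split.
- by move=> x; rewrite inE => Ox; have [->] := FP x.
- by apply: (continuous_extension_closure _ f) => x; have [] := FP x.
- move=> x clx; have [Ff _ bF] := FP x.
  have [Ox|nOx] := pselect (Omega x).
    by left; rewrite Ff//; exact: fO'.
  have bx : boundary Omega x by exact/boundary_open.
  by right; exists x => //; exact: bF.
Qed.
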